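(* Let $X_1,\dots,X_n$ and $Y$ be Banach spaces, $X:= X_1\times \cdots \times X_n$, $G \subset X$ an open set, and let $f:G \to Y$ be a continuous mapping. Suppose that the spaces $\mathcal{L}(X_1, Y),\dots, \mathcal{L}(X_{n-1}, Y)$ are separable. Then there exists a first category set $A \subset G$ such that, for all $x \in G \setminus A$, the following implication holds: if $f$ has all Fréchet partial derivatives $f'_1(x),\dots,f'_n(x)$ at $x$, then $f$ is Fréchet differentiable at $x$.
   Context: All Banach spaces are real and nontrivial ($\neq\{0\}$). $X_1\times\cdots\times X_n$ is equipped with the maximum norm. $\mathcal{L}(X_i,Y)$ is the Banach space of continuous linear mappings $X_i\to Y$ with the operator norm. For $x=(x_1,\dots,x_n)\in G$, the partial Fréchet derivative $f'_i(x)\in\mathcal{L}(X_i,Y)$ is (if it exists) the Fréchet derivative at $x_i$ of the mapping $t\mapsto f(x_1,\dots,x_{i-1},t,x_{i+1},\dots,x_n)$, defined for those $t\in X_i$ for which the argument lies in $G$. A first category (meagre) set is a countable union of nowhere dense sets. *)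

(* Defs.v *)
From HB Require Import structures.
From mathcomp Require Import all_boot all_order all_algebra.
From mathcomp Require Import mathcomp_extra boolp classical_sets functions.
From mathcomp Require Import cardinality reals topology normedtype landau.
From mathcomp Require Import derive.

Set Implicit Arguments.
Unset Strict Implicit.
Unset Printing Implicit Defensive.

Import Order.TTheory GRing.Theory Num.Theory.
Import numFieldNormedType.Exports.

Local Open Scope classical_set_scope.
Local Open Scope ring_scope.

(* An alias, so that the norm topology below is not confused with the
   pointwise topologies attached to dependent function types. *)
Definition maxprod (I : finType) (X : I -> Type) : Type := forall i, X i.

Section maxprod_zmod.
Variables (I : finType) (X : I -> zmodType).
Implicit Types x y z : maxprod X.

HB.instance Definition _ := gen_eqMixin (maxprod X).
HB.instance Definition _ := gen_choiceMixin (maxprod X).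

Definition mp_zero : maxprod X := fun=> 0.
Definition mp_opp x : maxprod X := fun i => - x i.
Definition mp_add x y : maxprod X := fun i => x i + y i.

Fact mp_addA : associative mp_add.
Proof. by move=> x y z; apply: functional_extensionality_dep => i; exact: addrA. Qed.
Fact mp_addC : commutative mp_add.
Proof. by move=> x y; apply: functional_extensionality_dep => i; exact: addrC. Qed.
Fact mp_add0 : left_id mp_zero mp_add.
Proof. by move=> x; apply: functional_extensionality_dep => i; exact: add0r. Qed.
Fact mp_addN : left_inverse mp_zero mp_opp mp_add.
Proof. by move=> x; apply: functional_extensionality_dep => i; exact: addNr. Qed.

HB.instance Definition _ :=
  GRing.isZmodule.Build (maxprod X) mp_addA mp_addC mp_add0 mp_addN.

End maxprod_zmod.

Section maxprod_lmod.
Variables (R : pzRingType) (I : finType) (X : I -> lmodType R).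

Definition mp_scale (a : R) (x : maxprod X) : maxprod X := fun i => a *: x i.

Fact mp_scaleA a b x : mp_scale a (mp_scale b x) = mp_scale (a * b) x.
Proof. by apply: functional_extensionality_dep => i; exact: scalerA. Qed.
Fact mp_scale1 : left_id 1 mp_scale.
Proof. by move=> x; apply: functional_extensionality_dep => i; exact: scale1r. Qed.
Fact mp_scaleDr : right_distributive mp_scale +%R.
Proof. by move=> a x y; apply: functional_extensionality_dep => i; exact: scalerDr. Qed.
Fact mp_scaleDl x : {morph mp_scale^~ x : a b / a + b}.
Proof. by move=> a b; apply: functional_extensionality_dep => i; exact: scalerDl. Qed.

HB.instance Definition _ := GRing.Zmodule_isLmodule.Build R (maxprod X)
  mp_scaleA mp_scale1 mp_scaleDr mp_scaleDl.

End maxprod_lmod.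

Section maxprod_normed.
Variables (R : realType) (I : finType) (X : I -> normedModType R).
Implicit Types x y : maxprod X.

Definition maxnorm x : R := \big[Num.max/0]_i `|x i|.

Fact maxnorm_ge0 x : 0 <= maxnorm x.
Proof. exact: bigmax_ge_id. Qed.

Fact ler_maxnorm x i : `|x i| <= maxnorm x.
Proof. exact: le_bigmax. Qed.

Fact maxnorm_le x e : 0 <= e -> (forall i, `|x i| <= e) -> maxnorm x <= e.
Proof. by move=> e0 xe; apply/bigmax_leP; split. Qed.

Fact ler_maxnormD x y : maxnorm (x + y) <= maxnorm x + maxnorm y.
Proof.
apply: maxnorm_le => [|i]; first by rewrite addr_ge0 ?maxnorm_ge0.
by rewrite (le_trans (ler_normD _ _))// lerD ?ler_maxnorm.
Qed.

Fact maxnormZ (a : R) x : maxnorm (a *: x) = `|a| * maxnorm x.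
Proof.
rewrite /maxnorm (eq_bigr (fun i => `|a| * `|x i|)); last first.
  by move=> i _; exact: normrZ.
elim/big_ind2 : _ => [|? b ? d -> ->|//]; first by rewrite mulr0.
by rewrite maxr_pMr.
Qed.

Fact maxnorm_eq0 x : maxnorm x = 0 -> x = 0.
Proof.
move=> x0; apply: functional_extensionality_dep => i.
by apply/eqP; rewrite -normr_le0 -x0 ler_maxnorm.
Qed.

HB.instance Definition _ :=
  Lmodule_isNormed.Build R (maxprod X) ler_maxnormD maxnormZ maxnorm_eq0.

End maxprod_normed.

Section continuous_linear_maps.
Variables (R : realType) (V W : normedModType R).

Definition clinear : {pred V -> W} := mem [set f | linear f /\ continuous f].

Record clinType := CLin { clin_fun :> V -> W; _ : clin_fun \in clinear }.

HB.instance Definition _ := [isSub for clin_fun].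
HB.instance Definition _ := [Choice of clinType by <:].

Fact clinearP (f : V -> W) : reflect (linear f /\ continuous f) (f \in clinear).
Proof. by apply: (iffP idP); rewrite inE. Qed.

Fact clinear_submod_closed : submod_closed clinear.
Proof.
split=> [|a f g /clinearP[fl fc] /clinearP[gl gc]]; apply/clinearP; split.
- by move=> a x y; rewrite scaler0 addr0.
- by move=> x; exact: cvg_cst.
- move=> b x y; have E z : (a *: f + g) z = a *: f z + g z by [].
  by rewrite !E fl gl !scalerDr addrACA !scalerA [a * b]mulrC.
- by move=> x; apply: cvgD; [apply: cvgZr; exact: fc|exact: gc].
Qed.

HB.instance Definition _ :=
  GRing.isSubmodClosed.Build R (V -> W) clinear clinear_submod_closed.
HB.instance Definition _ := [SubChoice_isSubLmodule of clinType by <:].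

Implicit Types f g : clinType.

Definition opnorm f : R := sup [set `|f x| | x in [set x : V | `|x| <= 1]].

Fact clin_linear f : linear f.
Proof. by case/clinearP: (valP f). Qed.

Fact clin_continuous f : continuous f.
Proof. by case/clinearP: (valP f). Qed.

Fact clin_has_sup f : has_sup [set `|f x| | x in [set x : V | `|x| <= 1]].
Proof.
split; first by exists `|f 0|, 0 => //=; rewrite normr0.
pose h := GRing.isLinear.Build R V W *:%R f (@clin_linear f).
pose L : {linear V -> W} := HB.pack (f : V -> W) h.
have /(@linear_bounded_continuous _ _ _ L)/linear_boundedP :
  continuous L by exact: clin_continuous.
move=> /pinfty_ex_gt0[M M0 LM]; exists M => _ [x /= x1 <-].
by rewrite (le_trans (LM x))// ler_piMr// ltW.
Qed.

Fact ler_opnorm_ball f x : `|x| <= 1 -> `|f x| <= opnorm f.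
Proof. by move=> x1; apply: (sup_upper_bound (clin_has_sup f)); exists x. Qed.

Fact opnorm_le f e : (forall x, `|x| <= 1 -> `|f x| <= e) -> opnorm f <= e.
Proof.
move=> fe; apply: ge_sup; first by case: (clin_has_sup f).
by move=> _ [x x1 <-]; exact: fe.
Qed.

Fact opnorm_ge0 f : 0 <= opnorm f.
Proof. by rewrite (le_trans _ (@ler_opnorm_ball f 0 _)) ?normr0. Qed.

Fact ler_opnormD f g : opnorm (f + g) <= opnorm f + opnorm g.
Proof.
apply: opnorm_le => x x1.
by rewrite (le_trans (ler_normD _ _))// lerD// ler_opnorm_ball.
Qed.

Fact opnormZ (a : R) f : opnorm (a *: f) = `|a| * opnorm f.
Proof.
apply/eqP; rewrite eq_le; apply/andP; split.
  apply: opnorm_le => x x1; rewrite [X in `|X|](_ : _ = a *: f x)//.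
  by rewrite normrZ ler_wpM2l// ler_opnorm_ball.
have [->|a0] := eqVneq a 0; first by rewrite normr0 mul0r opnorm_ge0.
rewrite -ler_pdivlMl ?normr_gt0//; apply: opnorm_le => x x1.
rewrite ler_pdivlMl ?normr_gt0// -normrZ.
exact: (@ler_opnorm_ball (a *: f) x x1).
Qed.

Fact opnorm_eq0 f : opnorm f = 0 -> f = 0.
Proof.
move=> f0; apply/val_inj/funext => x /=.
have fB y : `|y| <= 1 -> f y = 0.
  by move=> y1; apply/eqP; rewrite -normr_le0 -f0 ler_opnorm_ball.
have [->|x0] := eqVneq x 0; first by rewrite fB ?normr0.
have fZ b y : f (b *: y) = b *: f y.
  have := clin_linear f b y 0; rewrite addr0 => ->.
  by rewrite (fB 0) ?normr0// addr0.
have := fB (`|x|^-1 *: x); rewrite normrZV ?unitfE ?normr_eq0// fZ.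
by move=> /(_ (lexx _))/eqP; rewrite scaler_eq0 invr_eq0 normr_eq0 (negPf x0) => /eqP.
Qed.

HB.instance Definition _ :=
  Lmodule_isNormed.Build R clinType ler_opnormD opnormZ opnorm_eq0.

End continuous_linear_maps.

Notation "''L' ( V , W )" := (clinType V W)
  (at level 8, format "''L' ( V ,  W )") : type_scope.

Section topological_notions.
Variable T : topologicalType.

Definition separable := exists2 D : set T, countable D & dense D.

Definition nowhere_dense (A : set T) := (closure A)° = set0.

Definition first_category (A : set T) :=
  exists2 F : nat -> set T, (forall k, nowhere_dense (F k)) & A = \bigcup_k F k.

End topological_notions.
Arguments separable : clear implicits.

(* The domain of t |-> f (x with i-th coordinate t) is a neighbourhood of x i
   when f is only meaningful on an open set containing x. *)
Definition partially_differentiable (R : realType) (I : finType)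
    (X : I -> normedModType R) (Y : normedModType R) (f : maxprod X -> Y)
    (x : maxprod X) (i : I) :=
  differentiable (fun t : X i => f (dfwith x i t)) (x i).

(* Main.v *)
From HB Require Import structures.
Require Import Defs.
From mathcomp Require Import all_boot all_order all_algebra.
From mathcomp Require Import mathcomp_extra boolp classical_sets functions.
From mathcomp Require Import cardinality reals topology normedtype landau.
From mathcomp Require Import derive.
From mathcomp Require Import interval_inference lra.

Set Implicit Arguments.
Unset Strict Implicit.
Unset Printing Implicit Defensive.

Import Order.TTheory GRing.Theory Num.Theory.
Import numFieldNormedType.Exports.

Local Open Scope classical_set_scope.
Local Open Scope ring_scope.

(* For a fixed continuous linear map L, the points x at which
   |f(x + t e_i) - f(x) - L t| <= e |t| holds for all |t| < d (the ball of
   radius d around x lying in G) form a closed set F, and F minus its interior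
   is nowhere dense. Letting L range over a dense sequence of L(X_i, Y) and d, e
   over the inverses of positive integers yields a meagre set off which the
   partial derivative f'_i(x), if it exists, is strict: the estimate it has
   at x holds uniformly at all points near x. The increment f(x + h) - f(x) is
   then split into n increments along single coordinates, of which only the last
   one need be based at x, so no separability is required of L(X_n, Y). *)

(** * Nowhere dense and meagre sets, dense sequences *)

Section category.
Variable T : topologicalType.

Lemma nowhere_dense_set0 : nowhere_dense (set0 : set T).
Proof. by rewrite /nowhere_dense closure0 interior0. Qed.

(** As [F] is closed, the closure of the difference stays in [F], so an interior point of this
    closure lies in [F°]. But [F°] is an open set that misses the difference. *)
Lemma closedD_interior_nowhere_dense (F : set T) :
  closed F -> nowhere_dense (F `\` F°).
Proof.
move=> cF; rewrite /nowhere_dense -subset0 => x Ux.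
have clF : closure (F `\` F°) `<=` F.
  by apply: subset_trans cF; apply: closureS; exact: subDsetl.
have Fx : nbhs x F° by apply/nbhs_interior; exact: interiorS Ux.
by have [y [[_ ?] ?]] := interior_subset Ux _ Fx.
Qed.

Lemma nowhere_dense_bigcup (I : countType) (F : I -> set T) :
  (forall i, nowhere_dense (F i)) -> first_category (\bigcup_i F i).
Proof.
(* Numbers that code no index contribute the empty set. *)
move=> ndF; exists (fun k => oapp F set0 (unpickle k)).
  move=> k; case: unpickle => [i|] /=; first exact: ndF.
  exact: nowhere_dense_set0.
apply/seteqP; split=> [x [i _ Fx]|x [k _]].
  by exists (pickle i) => //; rewrite pickleK.
by case: unpickle => [i|] //= Fx; exists i.
Qed.

Lemma first_category_set0 : first_category (set0 : set T).
Proof.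
by exists (fun=> set0); [move=> _; exact: nowhere_dense_set0|rewrite bigcup0].
Qed.

Lemma first_category_bigcup (I : countType) (A : I -> set T) :
  (forall i, first_category (A i)) -> first_category (\bigcup_i A i).
Proof.
move=> cA; have /choice[F FA] i : exists F : nat -> set T,
    (forall k, nowhere_dense (F k)) /\ A i = \bigcup_k F k.
  by have [F] := cA i; exists F.
rewrite (_ : \bigcup_i A i = \bigcup_p F p.1 p.2).
  by apply: nowhere_dense_bigcup => p; exact: (FA p.1).1.
apply/seteqP; split=> [x [i _]|x [[i k] _ Fx]].
  by rewrite (FA i).2 => -[k _ Fx]; exists (i, k).
by exists i => //; rewrite (FA i).2; exists k.
Qed.

Lemma separable_dense_sequence :
  [set: T] !=set0 -> separable T -> exists u : nat -> T, dense (range u).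
Proof.
(* An empty [D] has no enumeration; density in an inhabited space excludes it. *)
move=> T0 [D cD dD]; have /pfcard_geP[D0|[g]] := cD.
  by have [x []] := dD _ T0 openT; rewrite D0.
exists g; suff -> : range g = D by [].
apply/seteqP; split=> [_ [k _ <-]|x Dx]; first exact: funS.
exact: (@surj _ _ _ _ g).
Qed.

End category.

(** * Fréchet differentiability through bounded linear maps *)

Section differentiability.
Variables (R : realType) (V W : normedModType R).

HB.instance Definition _ (L : 'L(V, W)) :=
  GRing.isLinear.Build R V W *:%R (clin_fun L) (clin_linear L).

Lemma ler_opnorm (L : 'L(V, W)) (v : V) : `|L v| <= `|L| * `|v|.
Proof.
have [->|v0] := eqVneq v 0.
  by rewrite linear0 !normr0 mulr0.
rewrite -ler_pdivrMr ?normr_gt0// mulrC -[X in X * _]ger0_norm ?invr_ge0//.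
rewrite -normrZ -linearZ ler_opnorm_ball//.
by rewrite normrZV ?unitfE ?normr_eq0.
Qed.

(** From left to right the witness is the differential itself. Conversely, a continuous linear [L]
    with this estimate equals the differential by uniqueness. *)
Lemma differentiable_clinP (f : V -> W) (x : V) :
  differentiable f x <-> exists L : 'L(V, W), forall e : R, 0 < e ->
    \forall h \near 0, `|f (x + h) - f x - L h| <= e * `|h|.
Proof.
split=> [/diff_locallyP[dc /eqaddoP df]|[L Lf]].
  have dL : ('d f x : V -> W) \in @clinear R V W.
    by apply/clinearP; split=> //; exact: linearP.
  exists (CLin dL) => e e0; have := df _ e0.
  apply: filterS => h /=; rewrite !fctE/= [h + x]addrC.
  by rewrite opprD addrA.
have lc : continuous L by exact: clin_continuous.
have fl : f \o shift x = cst (f x) + (L : V -> W) +o_ (0 : V) id.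
  apply/eqaddoP => e e0; have := Lf _ e0; apply: filterS => t.
  by rewrite !fctE/= [t + x]addrC opprD addrA.
by apply/diff_locallyP; rewrite (diff_unique lc fl).
Qed.

End differentiability.

(** * Partial derivatives and their strictness at generic points *)

Section partial_derivatives.
Variables (R : realType) (n : nat) (X : 'I_n -> normedModType R).
Variable Y : normedModType R.
Implicit Types (x h : maxprod X) (f : maxprod X -> Y) (G : set (maxprod X)).

Definition coordvec i (t : X i) : maxprod X := dfwith (0 : maxprod X) i t.

Lemma norm_coordvec i (t : X i) : `|coordvec t| = `|t|.
Proof.
apply/eqP; rewrite eq_le; apply/andP; split.
  apply: maxnorm_le => // j; rewrite /coordvec.
  by case: dfwithP => // k _; rewrite normr0.
by have := ler_maxnorm (coordvec t) i; rewrite /coordvec dfwithin.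
Qed.

Lemma dfwith_coordvec x i (t : X i) : dfwith x i (x i + t) = x + coordvec t.
Proof.
apply: functional_extensionality_dep => j.
change (dfwith x i (x i + t) j = x j + coordvec t j).
have [<-|ij] := eqVneq i j; first by rewrite /coordvec !dfwithin.
by rewrite /coordvec !dfwithout// addr0.
Qed.

Definition is_partial_derivative f x i (L : X i -> Y) := forall e : R, 0 < e ->
  \forall t \near 0, `|f (x + coordvec t) - f x - L t| <= e * `|t|.

Lemma partially_differentiable_clinP f x i :
  partially_differentiable f x i <->
  exists L : 'L(X i, Y), is_partial_derivative f x L.
Proof.
have xi : x = dfwith x i (x i).
  rewrite -[x i]addr0 dfwith_coordvec -[LHS]addr0; congr (_ + _).
  by apply/esym/eqP; rewrite -normr_eq0 norm_coordvec normr0.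
apply: iff_trans; first exact: differentiable_clinP.
split=> -[L Lf]; exists L => e e0; have := Lf _ e0; apply: filterS => t;
  by rewrite dfwith_coordvec -xi.
Qed.

(** The ball condition keeps [x] and every [x + coordvec t] with [|t| < d] inside [G], where [f] is
    continuous; closedness depends on this. *)
Definition slope_set G f i (L : X i -> Y) (d e : R) : set (maxprod X) :=
  [set x | ball x d `<=` G /\ forall t : X i, `|t| < d ->
           `|f (x + coordvec t) - f x - L t| <= e * `|t|].

Lemma slope_set_closed G f i (L : X i -> Y) (d e : R) :
  {in G, continuous f} -> 0 < d -> closed (slope_set G f L d e).
Proof.
move=> fc d0 x clx.
have xdG : ball x d `<=` G.
  move=> y; rewrite -ball_normE/= => xyd.
  (* A point [z] of the slope set within this slack of [x] still has [y] in its ball of radius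
     [d]. *)
  have dxy : 0 < d - `|x - y| by rewrite subr_gt0.
  have [z [[zG _]]] := clx _ (nbhsx_ballx x _ dxy).
  rewrite -ball_normE/= => xz; apply: zG; rewrite -ball_normE/=.
  rewrite -(subrKA x) (le_lt_trans (ler_normD _ _))//.
  by rewrite [`|z - x|]distrC -ltrBrDr.
(* A strict failure at [x] would persist, by continuity for this fixed [t], at nearby points of the
   slope set. *)
split=> // t td; rewrite leNgt; apply/negP => lt_t.
have cfx : f z @[z --> x] --> f x by apply: fc; rewrite inE; apply/xdG/ballxx.
have cft : f (z + coordvec t) @[z --> x] --> f (x + coordvec t).
  apply: (@cvg_comp _ _ _ (fun z => z + coordvec t) f).
    exact: (cvgD cvg_id (cvg_cst _)).
  apply: fc; rewrite inE; apply: xdG.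
  by rewrite -ball_normE/= opprD addNKr normrN norm_coordvec.
have cvx : f (z + coordvec t) - f z - L t @[z --> x] -->
    f (x + coordvec t) - f x - L t by exact: cvgB (cvgB cft cfx) (cvg_cst _).
have [z [[_ zt]]] := clx _ (cvgr_norm_gt _ cvx _ lt_t).
by rewrite /= ltNge zt.
Qed.

Definition is_strict_partial_derivative f x i (L : X i -> Y) :=
  forall e : R, 0 < e ->
  \forall z \near x & t \near 0, `|f (z + coordvec t) - f z - L t| <= e * `|t|.

Lemma generic_strict_partial G f (i : 'I_n) : open G -> {in G, continuous f} ->
  separable 'L(X i, Y) ->
  exists A : set (maxprod X), [/\ A `<=` G, first_category A &
    forall x (L : 'L(X i, Y)), (G `\` A) x ->
      is_partial_derivative f x L -> is_strict_partial_derivative f x L].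
Proof.
move=> oG fc /separable_dense_sequence[|u du]; first by exists 0.
pose F (k : nat * nat * nat) :=
  slope_set G f (u k.1.1) k.1.2.+1%:R^-1 k.2.+1%:R^-1.
have cF k : closed (F k) by apply: slope_set_closed => //; rewrite invr_gt0.
exists (\bigcup_k (F k `\` (F k)°)); split.
- by move=> x [k _ [[xG _] _]]; apply: xG; apply: ballxx; rewrite invr_gt0.
- by apply: nowhere_dense_bigcup => k; exact: closedD_interior_nowhere_dense.
move=> x L [Gx nAx] Lx e e0.
(* The final error is [e'] from the slope set plus [e' / 2] from replacing [L] by [u j];
   [e' < e / 4] keeps the sum below [e]. *)
have e40 : 0 < e / 4 by rewrite divr_gt0.
have [m _ /(_ m (leqnn m))/= me] := near_infty_natSinv_lt (PosNum e40).
set e' := m.+1%:R^-1 in me.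
have e'0 : 0 < e' / 2 by rewrite divr_gt0// invr_gt0.
have [M [LM [j _ uM]]] : (ball L (e' / 2) `&` range u) !=set0.
  by apply: du; [exists L; exact: ballxx|exact: ball_open].
subst M; rewrite -ball_normE/= in LM.
have uL (t : X i) : `|u j t - L t| <= e' / 2 * `|t|.
  rewrite distrC (le_trans (ler_opnorm (L - u j) t))// ler_wpM2r//.
  exact: ltW.
have /nbhs_ballP[d1 /= d10 xd1] := Lx _ e'0.
have /nbhs_ballP[d2 /= d20 xd2] : nbhs x G by exact: open_nbhs_nbhs.
have d0 : 0 < Num.min d1 d2 by rewrite lt_min d10.
have [p _ /(_ p (leqnn p))/=] := near_infty_natSinv_lt (PosNum d0).
rewrite lt_min => /andP[pd1 pd2].
(* The bound [e'] is made of [e' / 2] for the derivative [L] at [x] and [e' / 2] for the distance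
   from [L] to [u j]. *)
have Fx : F (j, p, m) x.
  split=> [|t tp]; first by apply: subset_trans xd2; apply: le_ball; exact: ltW.
  have /xd1 /= fx : ball 0 d1 t.
    by rewrite -ball_normE/= sub0r normrN (lt_trans tp).
  rewrite -(subrKA (L t)) (le_trans (ler_normD _ _))//.
  have := uL t; rewrite distrC /= -/e' => ?.
  rewrite [e' in leRHS]splitr mulrDl; exact: lerD.
(* Genericity enters here: outside the exceptional set, membership in a slope set spreads to a
   neighbourhood. *)
have iFx : (F (j, p, m))° x.
  by apply: contrapT => nFx; apply: nAx; exists (j, p, m).
near=> z t.
have [_ /(_ t) fz] : F (j, p, m) z by near: z.
rewrite -(subrKA (u j t)) (le_trans (ler_normD _ _))//.
have tp : `|t| < p.+1%:R^-1 by near: t; apply: nbhs0_lt; rewrite invr_gt0.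
have := lerD (fz tp) (uL t); rewrite -/e' -mulrDl => /le_trans; apply.
by rewrite ler_wpM2r// -/e'; lra.
Unshelve. all: by end_near. Qed.

(** * Splitting an increment into single-coordinate steps *)

Definition tailvec k h : maxprod X := fun j => if (k <= j)%N then h j else 0.

Lemma norm_tailvec k h : `|tailvec k h| <= `|h|.
Proof.
apply: maxnorm_le => // j; rewrite /tailvec; case: ifP => _.
  exact: ler_maxnorm.
by rewrite normr0.
Qed.

Lemma tailvec0 h : tailvec 0 h = h.
Proof. by []. Qed.

Lemma tailvec_eq0 k h : (n <= k)%N -> tailvec k h = 0.
Proof.
move=> nk; apply: functional_extensionality_dep => j.
by rewrite /tailvec leqNgt (leq_trans (ltn_ord j) nk).
Qed.

Lemma tailvecS (i : 'I_n) h : tailvec i h = tailvec i.+1 h + coordvec (h i).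
Proof.
apply: functional_extensionality_dep => j.
change (tailvec i h j = tailvec i.+1 h j + coordvec (h i) j).
rewrite /tailvec /coordvec.
have [<-|ij] := eqVneq i j; first by rewrite leqnn ltnn dfwithin add0r.
by rewrite dfwithout// addr0 leq_eqVlt val_eqE (negPf ij).
Qed.

Lemma coord_continuous i : continuous (fun x => x i).
Proof.
move=> x U /nbhs_ballP[e /= e0 eU]; apply/nbhs_ballP; exists e => // z.
rewrite -ball_normE/= => xz; apply: eU; rewrite -ball_normE/=.
exact: le_lt_trans (ler_maxnorm (x - z) i) xz.
Qed.

(** With the partial derivatives for [L], this sum is the candidate differential. *)
Lemma clin_sum_continuous (L : forall i, 'L(X i, Y)) :
  continuous (fun h : maxprod X => \sum_i L i (h i)).
Proof.
apply: continuous_big => [|i _ h]; first exact: add_continuous.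
apply: continuous_comp; [exact: coord_continuous|exact: clin_continuous].
Qed.

(* Passing from [x + h] to [x] by deleting the coordinates of [h] from first to
   last: when the last one is deleted the base point is [x] itself, so there
   plain differentiability suffices. *)
Lemma strict_partial_differentiable f x :
  (forall i : 'I_n, partially_differentiable f x i) ->
  (forall (i : 'I_n) (L : 'L(X i, Y)), (i < n.-1)%N ->
    is_partial_derivative f x L -> is_strict_partial_derivative f x L) ->
  differentiable f x.
Proof.
move=> pf sf.
pose L i := projT1 (cid ((partially_differentiable_clinP f x i).1 (pf i))).
have Lf i : is_partial_derivative f x (L i).
  exact: projT2 (cid ((partially_differentiable_clinP f x i).1 (pf i))).
have dL : (fun h : maxprod X => \sum_i L i (h i)) \in @clinear R (maxprod X) Y.
  apply/clinearP; split; last exact: clin_sum_continuous.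
  move=> a h k; rewrite scaler_sumr -big_split; apply: eq_bigr => i _.
  exact: (linearP (L i)).
apply/differentiable_clinP; exists (CLin dL) => e e0.
(* Each coordinate gets the share [e / n.+1] of the error: the divisor is positive even for [n = 0],
   and [n] shares stay below [e]. *)
have n0 : 0 < n.+1%:R :> R by [].
have step (i : 'I_n) : \forall h \near (0 : maxprod X),
    `|f (x + tailvec i h) - f (x + tailvec i.+1 h) - L i (h i)|
      <= e / n.+1%:R * `|h i|.
  have en0 : 0 < e / n.+1%:R by rewrite divr_gt0.
  have [ilt|ige] := ltnP i n.-1.
    have [[P Q] /= [/nbhs_ballP[d1 /= d10 Pd1] /nbhs_ballP[d2 /= d20 Qd2]]
      PQ] := sf i (L i) ilt (Lf i) _ en0.
    (* The base point [x + tailvec i.+1 h] moves with [h] but tends to [x], so strictness applies to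
       it. *)
    near=> h; rewrite tailvecS addrA; apply: (PQ (_, _)); split=> /=.
      apply: Pd1; rewrite -ball_normE/= opprD addNKr normrN.
      apply: le_lt_trans (norm_tailvec _ _) _.
      by near: h; exact: nbhs0_lt.
    apply: Qd2; rewrite -ball_normE/= sub0r normrN.
    apply: le_lt_trans (ler_maxnorm h i) _.
    by near: h; exact: nbhs0_lt.
  have /nbhs_ballP[d /= d0 dx] := Lf i _ en0.
  near=> h; rewrite tailvecS addrA.
  have -> : tailvec i.+1 h = 0.
    by apply: tailvec_eq0; rewrite (leq_trans (leqSpred n)).
  rewrite addr0; apply: dx; rewrite -ball_normE/= sub0r normrN.
  apply: le_lt_trans (ler_maxnorm h i) _.
  by near: h; exact: nbhs0_lt.
apply: filterS (filter_forall _ step) => h steph.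
have -> : f (x + h) - f x - CLin dL h =
    \sum_(i < n) (f (x + tailvec i h) - f (x + tailvec i.+1 h) - L i (h i)).
  rewrite big_split/= sumrN; congr (_ - _).
  pose g k := f (x + tailvec k h).
  rewrite -(big_mkord xpredT (fun i => g i - g i.+1)).
  (* The sign is reversed because [telescope_sumr] sums the differences [g k.+1 - g k]. *)
  have -> : f (x + h) - f x = - (g n - g 0%N).
    by rewrite /g opprB tailvec0 (tailvec_eq0 _ (leqnn n)) addr0.
  rewrite -(telescope_sumr g (leq0n n)) -sumrN.
  by apply: eq_bigr => k _; rewrite opprB.
apply: le_trans (ler_norm_sum _ _ _) _.
apply: (@le_trans _ _ (\sum_(i < n) e / n.+1%:R * `|h|)).
  apply: ler_sum => i _; apply: le_trans (steph i) _.
  by rewrite ler_wpM2l ?divr_ge0 ?(ltW e0)//; exact: ler_maxnorm.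
rewrite sumr_const card_ord -mulrnAl ler_wpM2r// -mulr_natr mulrAC.
by rewrite ler_pdivrMr// ler_wpM2l ?(ltW e0)// ler_nat.
Unshelve. all: by end_near. Qed.

End partial_derivatives.

Theorem theorem4p5 (R : realType) (n : nat) (n_gt0 : (0 < n)%N)
    (X : 'I_n -> completeNormedModType R) (Y : completeNormedModType R)
    (X_nontrivial : forall i, exists x : X i, x <> 0)
    (Y_nontrivial : exists y : Y, y <> 0)
    (G : set (maxprod X)) (f : maxprod X -> Y) :
  open G ->
  {within G, continuous f} ->
  (forall i : 'I_n, (i < n.-1)%N -> separable 'L(X i, Y)) ->
  exists A : set (maxprod X),
    [/\ A `<=` G, first_category A &
        forall x, (G `\` A) x ->
          (forall i, partially_differentiable f x i) -> differentiable f x].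
Proof.
move=> oG fc sepL; rewrite continuous_open_subspace// in fc.
have genA (i : 'I_n) : exists A : set (maxprod X),
    [/\ A `<=` G, first_category A & (i < n.-1)%N ->
      forall x (L : 'L(X i, Y)), (G `\` A) x ->
        is_partial_derivative f x L -> is_strict_partial_derivative f x L].
  have [ilt|_] := boolP (i < n.-1)%N.
    have [A [AG cA sA]] := generic_strict_partial oG fc (sepL i ilt).
    by exists A; split.
  (* For the last coordinate the strictness requirement is vacuous, so nothing has to be removed. *)
  by exists set0; split => //; exact: first_category_set0.
have [A AP] := choice genA.
exists (\bigcup_i A i); split.
- by apply: bigcup_sub => i _; have [] := AP i.
- by apply: first_category_bigcup => i; have [] := AP i.
move=> x [Gx nAx] pf; apply: strict_partial_differentiable => // i L ilt.
have [_ _ /(_ ilt)] := AP i; apply; split=> // Ax.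
by apply: nAx; exists i.
Qed.
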